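(* Let $\nu=(\nu_s)_{s\ge1}$ and $N=(N_m)_{m\ge1}$ be sequences of non-negative integers, each with only finitely many nonzero terms, and let $\mathcal{J}=\{j\ge 1 \mid N_j>0\}$. Assume that $P_m\ge 0$ for every $m\in\mathcal{J}$. Then the number of off-diagonal solutions of the string center equation with data $(\nu,N)$ (counted modulo integer shifts of the unknowns and modulo permutations, as specified in the context) is equal to $R(\nu,N)$.
   Context: Notation. For sequences $\nu,N$ as in the claim put, for $m\ge1$, $$\gamma_m=\sum_{k\ge1}\min(m,k)\nu_k,\qquad P_m=P_m(\nu,N)=\gamma_m-2\sum_{k\ge1}\min(m,k)N_k .$$ String center equation (SCE). The unknowns are $u_{k\beta}\in\mathbb{R}/\mathbb{Z}$ for $k\in\mathcal{J}$, $1\le\beta\le N_k$. The equation is $$\sum_{k\in\mathcal J}\sum_{\beta=1}^{N_k}A_{m\alpha,k\beta}\,u_{k\beta}\equiv\frac{P_m+N_m+1}{2}\pmod{\mathbb{Z}}\qquad (m\in\mathcal{J},\ 1\le\alpha\le N_m),$$ where $A_{m\alpha,k\beta}=\delta_{mk}\delta_{\alpha\beta}(P_m+N_m)+2\min(m,k)-\delta_{mk}$. Off-diagonal solutions and their counting. A solution is off-diagonal if for each $k\in\mathcal{J}$ the elements $u_{k1},\dots,u_{kN_k}$ of $\mathbb{R}/\mathbb{Z}$ are pairwise distinct. Two solutions are identified if, for each $k$, they differ by a permutation of $(u_{k1},\dots,u_{kN_k})$; that is, for each $k$ one regards $(u_{k1},\dots,u_{kN_k})$ as an element of $\big((\mathbb{R}/\mathbb{Z})^{N_k}\setminus\Delta_{N_k}\big)/\mathfrak{S}_{N_k}$,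 where $\Delta_n$ is the set of $n$-tuples with at least two equal entries and $\mathfrak{S}_n$ is the symmetric group. If $\mathcal{J}=\emptyset$ the equation is void and the number of off-diagonal solutions is defined to be $1$. The number $R(\nu,N)$. If $\mathcal{J}\neq\emptyset$, $$R(\nu,N)=\det_{m,k\in\mathcal{J}}(F_{m,k})\prod_{m\in\mathcal{J}}\frac{1}{N_m}\binom{P_m+N_m-1}{N_m-1},\qquad F_{m,k}=\delta_{m,k}P_m+2\min(m,k)N_k,$$ and $R(\nu,N)=1$ if $\mathcal{J}=\emptyset$. Here $\binom{\xi}{n}=\xi(\xi-1)\cdots(\xi-n+1)/n!$ for $n\ge1$ and $\binom{\xi}{0}=1$. *)

(* Defs.v *)
From HB Require Import structures.
From mathcomp Require Import all_boot all_order all_algebra all_fingroup.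
From mathcomp Require Import finmap.
From mathcomp Require Import boolp classical_sets functions cardinality reals.

Set Implicit Arguments.
Unset Strict Implicit.
Unset Printing Implicit Defensive.

Import Order.TTheory GRing.Theory Num.Theory.
Local Open Scope fset_scope.
Local Open Scope classical_set_scope.
Local Open Scope quotient_scope.
Local Open Scope ring_scope.

(* A sequence (a_k)_{k >= 1} with finite support is read off a finitely
   supported function on nat; its value at 0 is never used. *)
Notation natseq := {fsfun nat -> nat with 0%N}.

Section Data.
Variables nu N : natseq.

Definition gam (m : nat) : int :=
  (\sum_(k <- finsupp nu | (0 < k)%N) minn m k * nu k)%N%:Z.

Definition P (m : nat) : int :=
  gam m - 2 * (\sum_(k <- finsupp N | (0 < k)%N) minn m k * N k)%N%:Z.

Definition J : {fset nat} := [fset j in finsupp N | (0 < j)%N].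

Lemma in_J j : (j \in J) = (0 < j)%N && (0 < N j)%N.
Proof. by rewrite !inE /= mem_finsupp andbC !lt0n. Qed.

(* The coefficient A_{m alpha, k beta}. *)
Definition SCE_coef (m alpha k beta : nat) : int :=
  ((m == k) && (alpha == beta))%:Z * (P m + (N m)%:Z)
  + 2 * (minn m k)%:Z - (m == k)%:Z.

Definition gbinom (xi : rat) (n : nat) : rat :=
  (\prod_(i < n) (xi - i%:R)) / (n`!)%:R.

Definition F (m k : nat) : rat :=
  ((m == k)%:Z * P m + 2 * (minn m k)%:Z * (N k)%:Z)%:~R.

(* For J empty this is the determinant of a 0 x 0 matrix times an empty
   product, that is, 1. *)
Definition R_number : rat :=
  \det (\matrix_(i < #|{: J}|, j < #|{: J}|)
          F (val (enum_val i)) (val (enum_val j)))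
  * \prod_(m : J) ((N (val m))%:R^-1
      * gbinom ((P (val m))%:~R + (N (val m))%:R - 1) (N (val m)).-1).

End Data.

Section Circle.
Variable R : realType.

Definition int_subgroup : zmodClosed R :=
  GRing.ZmodClosed.clone R (@Num.int_num_subdef R) _.

Definition circle : zmodType := Quotient.quot int_subgroup.

Definition to_circle (x : R) : circle :=
  \pi_(Quotient.quot int_subgroup) x.

Lemma to_circleP (x y : R) :
  reflect (to_circle x = to_circle y) (x - y \is a Num.int).
Proof.
have -> : (x - y \is a Num.int) = (x - y \in int_subgroup) by [].
by rewrite Quotient.idealrBE; apply: eqP.
Qed.

Lemma to_circleB (x y : R) : to_circle (x - y) = to_circle x - to_circle y.
Proof. by rewrite /to_circle !piE. Qed.

End Circle.

Section SCE.
Variables (R : realType) (nu N : natseq).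

Definition unknowns : Type := forall k : J N, 'I_(N (val k)) -> circle R.

Definition SCE : set unknowns :=
  [set u | forall (m : J N) (alpha : 'I_(N (val m))),
     \sum_(k : J N) \sum_(beta < N (val k))
        u k beta *~ SCE_coef nu N (val m) alpha (val k) beta
     = to_circle ((P nu N (val m) + (N (val m))%:Z + 1)%:~R / 2 : R)].

Definition off_diagonal : set unknowns :=
  [set u | forall k : J N, injective (u k)].

Definition perm_class (u : unknowns) : set unknowns :=
  [set v | forall k : J N, exists s : 'S_(N (val k)),
     forall beta, v k beta = u k (s beta)].

(* Off-diagonal solutions modulo permutations. For J empty, unknowns has
   exactly one element, and the set below is a singleton. *)
Definition off_diagonal_solutions : set (set unknowns) :=
  [set perm_class u | u in SCE `&` off_diagonal].

End SCE.

Arguments unknowns : clear implicits.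
Arguments SCE : clear implicits.
Arguments off_diagonal : clear implicits.
Arguments off_diagonal_solutions : clear implicits.

(* Main.v *)
(* For fixed m the equation reads Q_m u_{m alpha} = t_m with Q_m = P_m + N_m and
   t_m depending only on the sums of the unknowns, so u_{m1}, ..., u_{mN_m} are
   N_m distinct Q_m-th roots of a common point t_m.  Writing
   u_{m alpha} = x_m + j_{m alpha} / Q_m turns the equation into F x = b, where b
   depends on the sets {j_{m alpha}} only; by the Smith normal form this has
   det F solutions in the torus.  Hence there are det F * prod_m C(Q_m, N_m)
   pairs (x, j), and each class of solutions comes from prod_m Q_m of them (the
   choices of the roots x_m).  Finally (1/N) C(Q-1, N-1) = C(Q, N) / Q, and
   det F > 0 because the matrix min(m, k) is positive definite. *)
From HB Require Import structures.
Require Import Defs.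
From mathcomp Require Import all_boot all_order all_algebra all_fingroup.
From mathcomp Require Import finmap.
From mathcomp Require Import boolp classical_sets functions cardinality reals.
From mathcomp Require Import zify.

Import Order.TTheory GRing.Theory Num.Theory.
Local Open Scope classical_set_scope.
Local Open Scope ring_scope.

Set Implicit Arguments.
Unset Strict Implicit.
Unset Printing Implicit Defensive.

(** * Cardinality of sets by bijections, fibrations and products *)

Lemma card_eq_bij T U (A : set T) (B : set U) (f : T -> U) :
  (forall x, A x -> B (f x)) ->
  (forall x y, A x -> A y -> f x = f y -> x = y) ->
  (forall y, B y -> exists2 x, A x & f x = y) -> (A #= B)%card.
Proof.
move=> fAB finj fsurj.
have fbij : set_bij A B f.
  by split => // x y /set_mem Ax /set_mem Ay; apply: finj.
by have [g _] := Pbij fbij; exact: (pcard_eq g).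
Qed.

(** Number the base by [h] and each fibre by [g]; then [x] receives the number
    [h (f x) * n + g (f x) x], and division by [n] with remainder recovers both indices. *)
Lemma card_fibration T U (A : set T) (B : set U) (f : T -> U) (m n : nat) :
  (forall x, A x -> B (f x)) ->
  (forall y, B y -> (A `&` f @^-1` [set y] #= `I_n)%card) ->
  (B #= `I_m)%card -> (A #= `I_(m * n))%card.
Proof.
move=> fAB fibre /card_set_bijP[h [hB hinj hsurj]].
have /choice[g gP] y : exists g : T -> nat, B y ->
    set_bij (A `&` f @^-1` [set y]) `I_n g.
  have [By|nBy] := pselect (B y); last by exists (fun=> 0%N) => /nBy.
  by have /card_set_bijP[g ?] := fibre y By; exists g.
have glt x : A x -> (g (f x) x < n)%N.
  by move=> Ax; have [+ _ _] := gP _ (fAB _ Ax); apply.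
apply: (@card_eq_bij _ _ _ _ (fun x => h (f x) * n + g (f x) x)%N).
- move=> x Ax /=; have /= := hB _ (fAB _ Ax); have := glt _ Ax; nia.
- move=> x y Ax Ay e.
  have n0 : (0 < n)%N by apply: leq_ltn_trans (glt x Ax).
  have eh : h (f x) = h (f y).
    have := congr1 (divn^~ n) e.
    by rewrite /= !divnMDl // !divn_small ?addn0 ?glt.
  have eg : g (f x) x = g (f y) y by move: e; rewrite eh => /addnI.
  have ef : f x = f y by apply: hinj eh; apply/mem_set; apply: fAB.
  have [_ ginj _] := gP _ (fAB _ Ay).
  by apply: ginj; [exact/mem_set|exact/mem_set|rewrite -{1}ef eg].
- move=> z /= zlt.
  have n0 : (0 < n)%N by nia.
  have [|y By hy] := hsurj (z %/ n)%N; first by rewrite /= ltn_divLR.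
  have [_ _ gsurj] := gP _ By.
  have [|x [Ax /= fx] gx] := gsurj (z %% n)%N; first by rewrite /= ltn_mod.
  by exists x => //; rewrite fx hy gx -divn_eq.
Qed.

Lemma card_pred (T : finType) (A : {pred T}) :
  ([set x | x \in A] #= `I_#|A|)%card.
Proof.
apply: (@card_eq_bij _ _ _ _ (index^~ (enum A))).
- by move=> x /= xA; rewrite cardE index_mem mem_enum.
- move=> x y xA yA /= e.
  by rewrite -(nth_index x (s := enum A) (x := x)) ?mem_enum // e nth_index ?mem_enum.
- move=> i /= iA; have /card_gt0P[x0 _] : (0 < #|A|)%N by apply: leq_ltn_trans iA.
  exists (nth x0 (enum A) i); last by rewrite index_uniq ?enum_uniq // -cardE.
  by rewrite -mem_enum mem_nth // -cardE.
Qed.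

(** Numbering each [Y i] turns a choice function into a finite function with values below [k i]. The
    common bound [K] puts all values in one type, ['I_K.+1], which is nonempty even for [K = 0], as
    [inord] requires. *)
Lemma card_prod_set (I : finType) T (Y : I -> set T) (k : I -> nat) :
  (forall i, Y i #= `I_(k i))%card ->
  ([set f : I -> T | forall i, Y i (f i)] #= `I_(\prod_i k i))%card.
Proof.
move=> Yk.
have /choice[g gP] i : exists g : T -> nat, set_bij (Y i) `I_(k i) g.
  by have /card_set_bijP := Yk i.
pose K := (\max_i k i)%N.
have kK i : (k i <= K)%N by apply: leq_bigmax.
pose F (i : I) := [pred j : 'I_K.+1 | (j < k i)%N].
have cardF i : #|F i| = k i.
  rewrite -[RHS]card_ord -(fintype.card_image (f := widen_ord (leqW (kK i)))).
    apply: eq_card => j; apply/idP/fintype.imageP => [jF|[j' _ ->]]; last by rewrite inE /= ltn_ord.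
    by exists (Ordinal jF) => //; apply: val_inj.
  by move=> x y /(congr1 val) /= e; apply: val_inj.
have -> : (\prod_i k i)%N = #|family F|.
  rewrite card_family foldrE big_map big_enum /=.
  by apply: eq_bigr => i _; rewrite cardF.
apply: card_eq_trans (card_pred _).
have gK f : (forall i, Y i (f i)) -> forall i, (g i (f i) < k i)%N.
  by move=> Yf i; have [+ _ _] := gP i; apply.
have inordg f : (forall i, Y i (f i)) -> forall i, @inord K (g i (f i)) = g i (f i) :> nat.
  by move=> Yf i; rewrite inordK // ltnS (leq_trans (ltnW (gK f Yf i))).
apply: (@card_eq_bij _ _ _ _ (fun f => [ffun i => inord (g i (f i))] : {ffun I -> 'I_K.+1})).
- by move=> f Yf; apply/familyP => i; rewrite ffunE inE inordg // gK.
- move=> f f' Yf Yf' /ffunP e; apply/funext => i.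
  have [_ ginj _] := gP i; apply: ginj; rewrite ?in_setE //.
  by have := congr1 (@nat_of_ord _) (e i); rewrite !ffunE !inordg.
- move=> h /familyP hF.
  have /choice[f fP] i : exists x, Y i x /\ g i x = h i.
    have [_ _ gsurj] := gP i.
    by have [|x ? ?] := gsurj (h i); [exact: hF|exists x].
  exists f; first by move=> i; have [] := fP i.
  by apply/ffunP => i; rewrite ffunE; have [_ ->] := fP i; rewrite inord_val.
Qed.

(** * Torsion points of the circle and integer linear systems on the torus *)

Section Torus.
Variable R : realType.
Implicit Type t : circle R.

HB.instance Definition _ :=
  GRing.isZmodMorphism.Build R (circle R) (@to_circle R) (@to_circleB R).

Lemma to_circle_surj t : exists r : R, to_circle r = t.
Proof. by exists (generic_quotient.repr t); rewrite /to_circle reprK. Qed.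

Lemma to_circle_eq0 (r : R) : (to_circle r = 0) <-> (r \is a Num.int).
Proof.
by rewrite -(raddf0 (@to_circle R)); split=> [/to_circleP|rint];
   [|apply/to_circleP]; rewrite subr0.
Qed.

(** The order [d] is a signed integer because it will be a diagonal entry of a Smith normal form,
    whose sign is not controlled. *)
Definition torsion_pt (d : int) (j : nat) : circle R := to_circle (j%:R / d%:~R).

Lemma torsion_pt_mulz (d : int) (j : nat) : d != 0 -> torsion_pt d j *~ d = 0.
Proof.
move=> d0; rewrite -raddfMz -mulrzr divfK ?intr_eq0 //.
by apply/to_circle_eq0; rewrite natr_int.
Qed.

Lemma torsion_pt_inj (d : int) (i j : nat) :
  (i < `|d|)%N -> (j < `|d|)%N -> torsion_pt d i = torsion_pt d j -> i = j.
Proof.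
move=> lti ltj; have dR0 : d%:~R != 0 :> R by rewrite intr_eq0; lia.
move=> /to_circleP; rewrite -mulrBl => /intrP[z /(canRL (mulfVK dR0))].
rewrite !pmulrn -intrB -intrM => /eqP; rewrite eqr_int => /eqP e.
(* Here [i - j = z * d] while [i] and [j] both lie below the absolute value of [d], which forces
   [z = 0]. *)
have [z0|z0] := eqVneq z 0; first by move: e; rewrite z0 mul0r; lia.
have := congr1 absz e; rewrite abszM; have : (0 < `|z|)%N by rewrite absz_gt0.
by move: lti ltj; nia.
Qed.

Lemma torsion_ptP (d : int) (y : circle R) : d != 0 -> y *~ d = 0 ->
  exists2 j : nat, (j < `|d|)%N & y = torsion_pt d j.
Proof.
move=> d0; have dR0 : d%:~R != 0 :> R by rewrite intr_eq0.
have [s <-] := to_circle_surj y.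
rewrite -raddfMz -mulrzr => /to_circle_eq0/intrP[z ez].
(* With [s] a real lift of [y], the product [s * d] is an integer [z]. Its quotient by [d] is an
   integer shift of [s], invisible in the circle, so only the remainder matters. *)
exists `|(z %% d)%Z|%N; first by have := ltz_mod z d0; have := modz_ge0 z d0; lia.
apply/to_circleP; rewrite -[s](mulfK dR0) -mulrBl ez.
have -> : z%:~R = (z %/ d)%Z%:~R * d%:~R + `|(z %% d)%Z|%:R :> R.
  by rewrite natr_absz (ger0_norm (modz_ge0 _ d0)) {1}(divz_eq z d) intrD intrM.
by rewrite addrK mulfK ?intr_int.
Qed.

(** The circle is divisible, so one root exists; the others are its translates by the
    [d]-torsion. *)
Lemma card_circle_roots t (d : int) : d != 0 ->
  ([set y | y *~ d = t] #= `I_`|d|)%card.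
Proof.
move=> d0; have [y0 y0P] : exists y0, y0 *~ d = t.
  have [r <-] := to_circle_surj t; exists (to_circle (r / d%:~R)).
  by rewrite -raddfMz -mulrzr divfK ?intr_eq0.
apply: card_esym; apply: (@card_eq_bij _ _ _ _ (fun j => y0 + torsion_pt d j)).
- by move=> j _ /=; rewrite mulrzDl torsion_pt_mulz // addr0.
- by move=> i j lti ltj /addrI; apply: torsion_pt_inj.
- move=> y /= yP; have [|j ltj yE] := @torsion_ptP d (y - y0) d0.
    by rewrite mulrzBl yP y0P subrr.
  by exists j; rewrite // -yE addrC subrK.
Qed.

(** The circle is only a group, so matrix multiplication is replaced by integer multiples of its
    points. *)
Definition torus_act (m n : nat) (A : 'M[int]_(m, n)) (x : 'I_n -> circle R) : 'I_m -> circle R :=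
  fun i => \sum_j x j *~ A i j.

Lemma torus_actM m n p (A : 'M_(m, n)) (B : 'M_(n, p)) x :
  torus_act (A *m B) x = torus_act A (torus_act B x).
Proof.
apply/funext => i; rewrite /torus_act.
under [RHS]eq_bigr do rewrite mulrz_suml.
rewrite exchange_big /=; apply: eq_bigr => j _; rewrite mxE mulrz_sumr.
by apply: eq_bigr => k _; rewrite mulrC mulrzA.
Qed.

Lemma torus_act1 n x : torus_act (1%:M : 'M_n) x = x.
Proof.
apply/funext => i; rewrite /torus_act (bigD1 i) //= big1 ?addr0 ?mxE ?eqxx //.
by move=> j ne; rewrite mxE eq_sym (negPf ne).
Qed.

Lemma card_torus_diag (I : finType) (d : I -> int) (c : I -> circle R) :
  (forall i, d i != 0) ->
  ([set x : I -> circle R | forall i, x i *~ d i = c i] #= `I_(\prod_i `|d i|))%card.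
Proof.
move=> d0; apply: (card_prod_set (Y := fun i => [set y | y *~ d i = c i])) => i.
exact: card_circle_roots.
Qed.

(** In the Smith form [A = L D S] the unimodular factors act bijectively on the torus, which leaves
    a diagonal system. They change the determinant only by a sign, hence the absolute value. *)
Lemma card_torus_act n (A : 'M[int]_n) (c : 'I_n -> circle R) : \det A != 0 ->
  ([set x | torus_act A x = c] #= `I_`|\det A|)%card.
Proof.
have [L Lu [S Su [d _ AE]]] := int_Smith_normal_form A.
pose D : 'M[int]_n := \matrix_(i, j) (d`_i *+ (i == j :> nat)).
have detD : \det D = \prod_(i < n) d`_i.
  have -> : D = diag_mx (\row_i d`_i).
    by apply/matrixP => i j; rewrite !mxE.
  by rewrite det_diag; apply: eq_bigr => i _; rewrite mxE.
have abs_unit (B : 'M[int]_n) : B \in unitmx -> `|\det B|%N = 1%N.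
  by rewrite unitmxE => /orP[] /eqP->.
rewrite AE !det_mulmx !abszM (abs_unit L) // (abs_unit S) // mul1n muln1 -/D detD.
rewrite !mulf_eq0 !negb_or => /andP[/andP[_ /prodf_neq0 d0] _].
rewrite (big_morph _ abszM (erefl _)).
apply: card_eq_trans (card_torus_diag (torus_act (invmx L) c) (fun i => d0 i isT)).
have actD x i : torus_act D x i = x i *~ d`_i.
  rewrite /torus_act (bigD1 i) //= big1 ?addr0 ?mxE ?eqxx //.
  by move=> j ne; rewrite mxE (inj_eq val_inj) eq_sym (negPf ne) mulr0n mulr0z.
apply: (@card_eq_bij _ _ _ _ (torus_act S)).
- move=> x /= <- i.
  by rewrite -actD -!torus_actM !mulmxA mulVmx // mul1mx.
- move=> x y _ _ e.
  by rewrite -[x]torus_act1 -[y]torus_act1 -(mulVmx Su) !torus_actM e.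
- move=> y yP; exists (torus_act (invmx S) y) => /=.
    rewrite -torus_actM (mulmxK Su) torus_actM.
    have -> : torus_act D y = torus_act (invmx L) c by apply/funext => i; rewrite actD yP.
    by rewrite -torus_actM mulmxV ?torus_act1.
  by rewrite -torus_actM mulmxV ?torus_act1.
Qed.

End Torus.

Lemma card_torus_system (R : realType) (I : finType) (A : I -> I -> int)
    (c : I -> circle R) :
  let D := \det (\matrix_(i < #|I|, j < #|I|) A (enum_val i) (enum_val j)) in
  D != 0 ->
  ([set x : I -> circle R | forall i, \sum_j x j *~ A i j = c i] #= `I_`|D|)%card.
Proof.
move=> /= D0; apply: card_eq_trans (card_torus_act (c \o enum_val) D0).
have sumE (x : I -> circle R) (i : 'I_#|I|) :
    torus_act (\matrix_(i < #|I|, j < #|I|) A (enum_val i) (enum_val j)) (x \o enum_val) i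
    = \sum_j x j *~ A (enum_val i) j.
  rewrite /torus_act [RHS](reindex (@enum_val I predT)) /=; last first.
    exact/onW_bij/enum_val_bij.
  by apply: eq_bigr => j _; rewrite mxE.
apply: (@card_eq_bij _ _ _ _ (fun (x : I -> circle R) (i : 'I_#|I|) => x (enum_val i))).
- by move=> x /= xP; apply/funext => i; rewrite sumE xP.
- move=> x y _ _ /(congr1 (fun f => f \o enum_rank)) e.
  by apply/funext => i; have /= := congr1 (@^~ i) e; rewrite enum_rankK.
- move=> y /= yP; have yE : (y \o enum_rank) \o enum_val = y.
    by apply/funext => i /=; rewrite enum_valK.
  exists (y \o enum_rank) => // i.
  by rewrite -[i]enum_rankK -sumE yE yP /= enum_rankK.
Qed.

(** * Positivity of the determinant of a diagonal matrix plus the min matrix *)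

Lemma sum_sqr_gt0 (R : realDomainType) (n : nat) (v : 'rV[R]_n) :
  v != 0 -> 0 < \sum_i v 0 i ^+ 2.
Proof.
move=> v0; rewrite lt0r sumr_ge0 ?andbT => [|i _]; last exact: sqr_ge0.
apply: contra v0; rewrite psumr_eq0 => [/allP vz|i _]; last exact: sqr_ge0.
apply/eqP/rowP => i; rewrite mxE; apply/eqP.
by rewrite -sqrf_eq0; apply: (implyP (vz i (mem_index_enum i))).
Qed.

(* The segment from A to the identity consists of positive definite, hence
   invertible, matrices, so the determinant keeps its sign along it. *)
Lemma det_posdef_gt0 (R : rcfType) (n : nat) (A : 'M[R]_n) :
  (forall v : 'rV_n, v != 0 -> 0 < (v *m A *m v^T) 0 0) -> 0 < \det A.
Proof.
move=> Apos; rewrite ltNge; apply/negP => detA.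
pose B (s : R) := s%:M + (1 - s) *: A.
pose p : {poly R} := \det ('X%:M + (1 - 'X) *: map_mx polyC A).
have pE s : p.[s] = \det (B s).
  rewrite -[p.[s]]/(horner_eval s p) -det_map_mx; congr (\det _).
  apply/matrixP => i j; rewrite !mxE.
  by rewrite rmorphD rmorphM rmorphB rmorph1 rmorphMn /= /horner_eval hornerX hornerC.
(* The polynomial takes the value [\det A <= 0] at 0 and the value 1 at 1, so some matrix of the
   segment is singular. *)
have [|s /andP[s0 s1] /rootP] := @poly_ivt R p 0 1 ler01.
  by rewrite !pE /B subr0 scale1r raddf0 subrr scale0r add0r addr0 det1 detA ler01.
rewrite pE => /eqP/det0P[v v0 vB].
have vv : (v *m v^T) 0 0 = \sum_i v 0 i ^+ 2.
  by rewrite mxE; apply: eq_bigr => i _; rewrite mxE expr2.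
have := sum_sqr_gt0 v0; have := Apos v v0; rewrite -vv.
have : ((v *m B s) *m v^T) 0 0 = 0 by rewrite vB mul0mx mxE.
rewrite mulmxDr mulmxDl mul_mx_scalar -!scalemxAr -!scalemxAl.
move: (v *m v^T) (v *m A *m v^T) => x y; rewrite !mxE => e yA xv.
have [s_eq0|s_neq0] := eqVneq s 0.
  by move: e yA; rewrite s_eq0 mul0r subr0 mul1r add0r => ->; rewrite ltxx.
suff : 0 < (0 : R) by rewrite ltxx.
rewrite -{2}e ltr_pwDl // ?mulr_ge0 ?subr_ge0 ?(ltW yA) // mulr_gt0 //.
by rewrite lt0r s_neq0.
Qed.

(* min(a, b) counts the t with t < a and t < b, so the form attached to
   min(a_i, a_j) is a sum of squares of tail sums, which determine v. *)
Lemma posdef_minn (R : realDomainType) (n : nat) (a : 'I_n -> nat) (v : 'rV[R]_n) :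
  injective a -> (forall i, 0 < a i)%N -> v != 0 ->
  0 < \sum_i \sum_j v 0 i * v 0 j * (minn (a i) (a j))%:R.
Proof.
move=> ainj a0 v0; pose K := (\max_i a i)%N.
have aK i : (a i <= K)%N by apply: leq_bigmax.
pose S t := \sum_(i | (t < a i)%N) v 0 i.
have minE i j : (minn (a i) (a j))%:R = \sum_(t < K) (t < a i)%N%:R * (t < a j)%N%:R :> R.
  under eq_bigr do rewrite -natrM mulnb -leq_min.
  have le : (minn (a i) (a j) <= K)%N by rewrite geq_min aK.
  by rewrite -natr_sum -big_mkcond /= -(big_ord_widen _ (fun=> 1%N) le) sum1_card card_ord.
have -> : \sum_i \sum_j v 0 i * v 0 j * (minn (a i) (a j))%:R = \sum_(t < K) S t ^+ 2.
  under [RHS]eq_bigr => t _.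
    rewrite expr2 mulr_suml big_mkcond /=.
    over.
  rewrite [RHS]exchange_big; apply: eq_bigr => i _ /=.
  under [LHS]eq_bigr do rewrite minE mulr_sumr.
  rewrite exchange_big; apply: eq_bigr => t _ /=.
  case: (t < a i)%N; last by apply: big1 => j _; rewrite mul0r mulr0.
  rewrite mulr_sumr [RHS]big_mkcond; apply: eq_bigr => j _ /=.
  by case: (t < a j)%N; rewrite ?mulr1 ?mulr0.
rewrite lt0r sumr_ge0 ?andbT => [|t _]; last exact: sqr_ge0.
apply: contra v0; rewrite psumr_eq0 => [/allP Sz|t _]; last exact: sqr_ge0.
have S0 t : S t = 0.
  have [tK|Kt] := ltnP t K.
    by apply/eqP; rewrite -sqrf_eq0; apply: (implyP (Sz (Ordinal tK) (mem_index_enum _))).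
  by apply: big_pred0 => i; apply/negbTE; rewrite -leqNgt (leq_trans (aK i)).
(* Since [a] is injective, passing from the threshold [a i] down to [(a i).-1] adds exactly the term
   [v 0 i] to the tail sum. *)
apply/eqP/rowP => i; rewrite mxE; have := S0 (a i).-1.
rewrite /S (bigD1 i) /= ?prednK //.
rewrite (eq_bigl (fun j => (a i < a j)%N)) => [|j]; first by rewrite -/(S _) S0 addr0.
by rewrite [RHS]ltn_neqAle eq_sym (inj_eq ainj) andbC.
Qed.

(** The diagonal contributes a nonnegative quadratic form and the min matrix a positive definite
    one. *)
Lemma det_diag_minn_gt0 (R : rcfType) (n : nat) (a : 'I_n -> nat) (d : 'I_n -> R) :
  injective a -> (forall i, 0 < a i)%N -> (forall i, 0 <= d i) ->
  0 < \det (\matrix_(i, j) ((i == j)%:R * d i + 2 * (minn (a i) (a j))%:R)).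
Proof.
move=> ainj a0 d0; apply: det_posdef_gt0 => v v0.
have -> : (v *m (\matrix_(i, j) ((i == j)%:R * d i + 2 * (minn (a i) (a j))%:R)) *m v^T) 0 0
    = \sum_i v 0 i ^+ 2 * d i + 2 * \sum_i \sum_j v 0 i * v 0 j * (minn (a i) (a j))%:R.
  rewrite mulr_sumr -big_split mxE.
  under [LHS]eq_bigr do rewrite mxE mulr_suml.
  rewrite [LHS]exchange_big; apply: eq_bigr => i _ /=.
  under eq_bigr do rewrite !mxE mulrDr mulrDl.
  rewrite big_split (bigD1 i) //= eqxx mul1r big1 ?addr0 => [|j ne]; last first.
    by rewrite eq_sym (negPf ne) mul0r mulr0 mul0r.
  rewrite mulr_sumr; congr (_ + _); first by rewrite mulrAC expr2.
  by apply: eq_bigr => j _; rewrite [LHS]mulrAC mulrCA.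
rewrite ltr_wpDl ?mulr_gt0 ?posdef_minn //.
by apply: sumr_ge0 => i _; rewrite mulr_ge0 ?sqr_ge0.
Qed.

(** * Counting families of sets through base points and offsets *)

Definition draws (I T : finType) (B : I -> {set T}) (n : I -> nat) :=
  family (fun i => [set A : {set T} | A \subset B i & #|A| == n i]).

Lemma card_draws_family (I T : finType) (B : I -> {set T}) (n : I -> nat) :
  #|draws B n| = (\prod_i 'C(#|B i|, n i))%N.
Proof.
rewrite card_family foldrE big_map big_enum /=.
by apply: eq_bigr => i _; rewrite cards_draws.
Qed.

Lemma perm_fset_seq (T : choiceType) (s : seq T) : uniq s -> perm_eq [fset y in s]%fset s.
Proof. by move=> us; apply: uniq_perm => // y; rewrite !inE. Qed.

Section SubsetCount.
Variables (R : realType) (I : finType) (q n : I -> nat) (C : I -> I -> int).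
Variable c : I -> circle R.
Hypothesis q_gt0 : forall i, (0 < q i)%N.

(* W i stands for the set of unknowns of colour i, so that off-diagonal classes
   become families of finite sets. *)
Definition bethe_sets : set (I -> {fset circle R}) :=
  [set W | forall i, #|` W i| = n i /\
    forall y, y \in W i ->
      y *~ q i + \sum_j (\sum_(z <- W j) z) *~ C i j = c i].

(** Coefficients of the base points [x] after writing the elements of [W i] as [x i + t / q i]: the
    sum over [W j] contains [x j] exactly [n j] times. *)
Definition bethe_mx (i j : I) : int := (i == j)%:Z * (q i)%:Z + C i j * (n j)%:Z.

Variable K : nat.
Hypothesis q_le : forall i, (q i <= K)%N.
Local Notation idx := 'I_K.

(** All colours share the index type [idx], so that families of index sets are ordinary finite
    functions; each colour is then cut down to its own [q i] residues. *)
Definition offsets (i : I) : {set idx} := [set j : idx | (j < q i)%N].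

Definition index_sets := draws offsets n.

(* A frame (x, a) encodes the family W i = {x i + t / q i | t in a i}. *)
Definition frames : set ((I -> circle R) * {ffun I -> {set idx}}) :=
  [set p | p.2 \in index_sets /\ forall i, \sum_j p.1 j *~ bethe_mx i j =
     c i - \sum_j (\sum_(t in p.2 j) torsion_pt R (q j) t) *~ C i j].

Definition frame_sets (p : (I -> circle R) * {ffun I -> {set idx}}) (i : I) :=
  [fset y in [seq (p.1 i + torsion_pt R (q i) t)%R | t : idx in p.2 i]]%fset.

Lemma card_index_sets : #|index_sets| = (\prod_i 'C(q i, n i))%N.
Proof.
rewrite card_draws_family; apply: eq_bigr => i _; congr 'C(_, _).
rewrite -sum1_card; under eq_bigl do rewrite inE.
by rewrite -(big_ord_widen _ (fun=> 1%N) (q_le i)) sum1_card card_ord.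
Qed.

Lemma index_setsP (a : {ffun I -> {set idx}}) : a \in index_sets ->
  (forall i (t : idx), t \in a i -> (t < q i)%N) /\ (forall i, #|a i| = n i).
Proof.
move=> /familyP aP; split=> i; have := aP i; rewrite inE => /andP[/fintype.subsetP sub /eqP //].
by move=> _ t /sub; rewrite inE.
Qed.

(** Distinct offsets below [q i] give distinct points, so no elements merge and both sums and sizes
    can be read off the offsets. *)
Lemma frame_sets_perm p i : p.2 \in index_sets ->
  perm_eq (frame_sets p i) [seq p.1 i + torsion_pt R (q i) t | t : idx in p.2 i].
Proof.
move=> /index_setsP[aq _]; apply: perm_fset_seq.
rewrite map_inj_in_uniq ?enum_uniq // => t t'; rewrite !mem_enum => /aq tq /aq t'q /addrI e.
by apply: val_inj; apply: torsion_pt_inj e.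
Qed.

(** Splitting each sum over [frame_sets p j] into [n j] copies of the base point and a sum of
    torsion points turns one equation into the other. *)
Lemma frame_sets_eq p i : p.2 \in index_sets ->
  (\sum_j p.1 j *~ bethe_mx i j =
     c i - \sum_j (\sum_(t in p.2 j) torsion_pt R (q j) t) *~ C i j) <->
  (p.1 i *~ q i + \sum_j (\sum_(z <- frame_sets p j) z) *~ C i j = c i).
Proof.
move=> pP; have [_ an] := index_setsP pP.
have -> : \sum_j p.1 j *~ bethe_mx i j = p.1 i *~ q i + \sum_j (p.1 j *+ n j) *~ C i j.
  under eq_bigr do rewrite mulrzDr.
  rewrite big_split /= (bigD1 i) //= eqxx mul1r big1 ?addr0 => [|j ne]; last first.
    by rewrite eq_sym (negPf ne) mul0r.
  by congr (_ + _); apply: eq_bigr => j _; rewrite mulrC mulrzA.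
have -> : \sum_j (\sum_(z <- frame_sets p j) z) *~ C i j =
    \sum_j (p.1 j *+ n j) *~ C i j
    + \sum_j (\sum_(t in p.2 j) torsion_pt R (q j) t) *~ C i j.
  rewrite -big_split; apply: eq_bigr => j _ /=; rewrite -mulrzDl; congr (_ *~ _).
  by rewrite (perm_big _ (frame_sets_perm j pP)) /= big_map big_enum /= big_split sumr_const an.
by rewrite addrA; split=> [->|<-]; rewrite ?subrK ?addrK.
Qed.

Lemma mem_frame_sets p i (t : idx) : p.2 \in index_sets -> (t < q i)%N ->
  (p.1 i + torsion_pt R (q i) t \in frame_sets p i) = (t \in p.2 i).
Proof.
move=> pP tq; have [aq _] := index_setsP pP; rewrite inE; apply/fintype.imageP/idP.
  move=> [t' t'a /addrI e].
  by have -> : t = t' by apply: val_inj; apply: torsion_pt_inj e; rewrite ?tq //; apply: aq.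
by move=> ta; exists t.
Qed.

Lemma frame_sets_bethe p : frames p -> bethe_sets (frame_sets p).
Proof.
case=> pP pE i; have [_ an] := index_setsP pP; split.
  by rewrite (perm_size (frame_sets_perm i pP)) size_map -cardE.
move=> y; rewrite inE => /fintype.imageP[t ta ->].
rewrite mulrzDl torsion_pt_mulz ?addr0; last by rewrite -lt0n.
exact/frame_sets_eq.
Qed.

(** Once [W] is fixed, the elements of [W i] are [q i]-th roots of a fixed point [t i]. A frame over
    [W] amounts to a choice of one root [x i] per colour: differences of roots are [q i]-torsion, so
    the offsets are forced by [x] and [W]. *)
Lemma card_frame_fibre W : bethe_sets W ->
  (frames `&` frame_sets @^-1` [set W] #= `I_(\prod_i q i))%card.
Proof.
move=> WP; have q0 i : (q i)%:Z != 0 by rewrite -lt0n.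
pose t i := c i - \sum_j (\sum_(z <- W j) z) *~ C i j.
apply: card_eq_trans (card_torus_diag t q0).
apply: (@card_eq_bij _ _ _ _ fst).
- move=> p [[pP pE] /= pW] i.
  by have /frame_sets_eq := pE i; rewrite pW /t => /(_ pP) <-; rewrite addrK.
- move=> [x a] [x' a'] [[/= aP _] /= aW] [[/= a'P _] /= a'W] /= xx'.
  rewrite -xx' in a'W *; congr pair; apply/ffunP => i; apply/setP => s.
  have [sq|sq] := ltnP s (q i).
    by rewrite -(mem_frame_sets (p := (x, a))) // aW -a'W (mem_frame_sets (p := (x, a'))).
  have [aq _] := index_setsP aP; have [a'q _] := index_setsP a'P.
  by apply/idP/idP => [/aq|/a'q]; rewrite ltnNge sq.
- move=> x /= xP.
  pose a : {ffun I -> {set idx}} :=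
    [ffun i => finset (fun s : idx => (s < q i)%N && (x i + torsion_pt R (q i) s \in W i))].
  have aW i : [seq x i + torsion_pt R (q i) s | s : idx in a i] =i W i.
    move=> y; apply/fintype.imageP/idP => [[s + ->]|yW]; first by rewrite ffunE inE => /andP[].
    have [|s sq ys] := @torsion_ptP _ (q i) (y - x i) (q0 i).
      rewrite mulrzBl xP /t; have [_ /(_ y yW) <-] := WP i.
      by rewrite addrK subrr.
    have sK : (s < K)%N by apply: leq_trans (q_le i).
    have yE : y = x i + torsion_pt R (q i) (Ordinal sK) by rewrite -ys addrC subrK.
    by exists (Ordinal sK) => //; rewrite ffunE inE -yE yW andbT.
  have aP : a \in index_sets.
    apply/familyP => i; rewrite inE; apply/andP; split.
      by apply/fintype.subsetP => s; rewrite ffunE !inE => /andP[].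
    have [<- _] := WP i; apply/eqP.
    rewrite [LHS]cardE -(size_map (fun s : idx => x i + torsion_pt R (q i) s)).
    apply/perm_size/uniq_perm; [|exact: fset_uniq|exact: aW].
    rewrite map_inj_in_uniq ?enum_uniq // => s s'; rewrite !mem_enum ffunE !inE.
    by move=> /andP[sq _] /andP[s'q _] /addrI e; apply: val_inj; apply: torsion_pt_inj e.
  have fW : frame_sets (x, a) = W.
    by apply/funext => i; apply/fsetP => y; rewrite inE -aW.
  exists (x, a) => //; split => //; split => // i.
  by apply/frame_sets_eq; rewrite // fW /= xP /t subrK.
Qed.

(* Both sides of the last equation count frames: by the sets W they define, and
   by their offsets. *)
Lemma card_bethe_sets :
  let D := \det (\matrix_(i < #|I|, j < #|I|) bethe_mx (enum_val i) (enum_val j)) in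
  D != 0 -> exists m, (bethe_sets #= `I_m)%card /\
    (m * \prod_i q i = \prod_i 'C(q i, n i) * `|D|)%N.
Proof.
move=> D D0.
have framesE : (frames #= `I_(#|index_sets| * `|D|))%card.
  apply: (card_fibration (f := snd) (B := [set a | a \in index_sets])).
  - by move=> p [].
  - move=> a /= aP.
    (* With the offsets fixed, the frame equation is a linear system in [x] with matrix
       [bethe_mx]. *)
    pose t i := c i - \sum_j (\sum_(s in a j) torsion_pt R (q j) s) *~ C i j.
    apply: card_eq_trans (card_torus_system t D0).
    apply: (@card_eq_bij _ _ _ _ fst).
    + by move=> [x b] [[/= _ +] /= ba] i => /(_ i); rewrite ba.
    + by move=> [x b] [x' b'] [_ /= ->] [_ /= ->] /= ->.
    + by move=> x xP; exists (x, a).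
  - exact: card_pred.
(* Finiteness is needed for a number [m] to exist. It holds because every fibre over [bethe_sets]
   has [\prod_i q i > 0] elements, so [bethe_sets] is an image of the finite set [frames]. *)
have /finite_setP[m mP] : finite_set bethe_sets.
  have -> : bethe_sets = frame_sets @` frames.
    apply/seteqP; split=> [W WP|_ [p pF <-]]; last exact: frame_sets_bethe.
    have prod_gt0 : (0 < \prod_i q i)%N by rewrite prodn_gt0.
    apply: contrapT => noframe; have := card_frame_fibre WP.
    have -> : frames `&` frame_sets @^-1` [set W] = set0.
      by apply/seteqP; split=> // p [pF pW]; case: noframe; exists p.
    rewrite card_eq_sym card_eq0 => /eqP/seteqP[k0 _].
    exact: (k0 0%N prod_gt0).
  by apply: finite_image; apply/finite_setP; exists (#|index_sets| * `|D|)%N.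
exists m; split => //; rewrite -card_index_sets; apply/card_eq_II.
apply: card_eq_trans framesE; apply: card_esym.
by apply: card_fibration mP; [exact: frame_sets_bethe|exact: card_frame_fibre].
Qed.

End SubsetCount.

(** * From permutation classes of solutions to families of sets *)

Section Classes.
Variables (R : realType) (nu N : natseq).
Implicit Types (u v : unknowns R N).

Lemma sum_fset_codom u (k : J N) : injective (u k) ->
  \sum_(z <- [fset y in codom (u k)]%fset) z = \sum_beta u k beta.
Proof.
move=> uinj; rewrite (perm_big _ (perm_fset_seq _)) /=.
  by rewrite big_map big_enum.
by rewrite map_inj_uniq ?enum_uniq.
Qed.

Lemma perm_class_codom u v k : perm_class u v -> codom (u k) =i codom (v k).
Proof.
move=> /(_ k)[s vE] y; apply/codomP/codomP => -[beta ->].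
  by exists (s^-1%g beta); rewrite vE permKV.
by exists (s beta).
Qed.

Lemma perm_class_refl u : perm_class u u.
Proof. by move=> k; exists 1%g => beta; rewrite perm1. Qed.

Lemma perm_class_eq u v : perm_class u v -> perm_class u = perm_class v.
Proof.
move=> uv; apply/seteqP; split=> w uw k.
  have [[s vE] [r wE]] := (uv k, uw k); exists (r * s^-1)%g => beta.
  by rewrite vE permM permKV.
have [[s vE] [r wE]] := (uv k, uw k); exists (r * s)%g => beta.
by rewrite wE vE permM.
Qed.

(** Choosing a preimage under [u k] of each value of [v k] gives an injective self-map of a finite
    set, hence a permutation. *)
Lemma codom_perm_class u v : off_diagonal R N v ->
  (forall k, codom (u k) =i codom (v k)) -> perm_class u v.
Proof.
move=> voff uv k.
have vinu beta : v k beta \in codom (u k) by rewrite uv codom_f.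
have sinj : injective (fun beta => iinv (vinu beta)).
  by move=> b b' /(congr1 (u k)); rewrite !f_iinv; apply: voff.
by exists (perm sinj) => beta; rewrite permE f_iinv.
Qed.

(** The number of roots must be a natural number; [absz] leaves the value unchanged once [P] is
    nonnegative on [J]. *)
Definition bethe_q (k : J N) : nat := absz (P nu N (val k) + (N (val k))%:Z).
(** The part of [SCE_coef] that does not depend on [alpha] and [beta], so that it multiplies only
    the sums of the unknowns of each colour. *)
Definition bethe_C (k l : J N) : int := 2 * (minn (val k) (val l))%:Z - (k == l)%:Z.
Definition bethe_rhs (k : J N) : circle R :=
  to_circle ((P nu N (val k) + (N (val k))%:Z + 1)%:~R / 2 : R).

Hypothesis P_ge0 : forall m : nat, m \in J N -> 0 <= P nu N m.

Lemma bethe_qE k : (bethe_q k)%:Z = P nu N (val k) + (N (val k))%:Z.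
Proof. by rewrite /bethe_q; have := P_ge0 (valP k); lia. Qed.

Lemma SCE_lhs u (m : J N) (alpha : 'I_(N (val m))) :
  \sum_(k : J N) \sum_(beta < N (val k)) u k beta *~ SCE_coef nu N (val m) alpha (val k) beta
  = u m alpha *~ bethe_q m + \sum_k (\sum_beta u k beta) *~ bethe_C m k.
Proof.
have coefE (k : J N) beta : SCE_coef nu N (val m) alpha (val k) beta =
    ((m == k) && (alpha == beta :> nat))%:Z * bethe_q m + bethe_C m k.
  by rewrite /SCE_coef /bethe_C bethe_qE val_eqE addrA.
under eq_bigr do under eq_bigr do rewrite coefE mulrzDr.
under eq_bigr do rewrite big_split /= -mulrz_suml.
rewrite big_split /=; congr (_ + _).
rewrite (bigD1 m) //= [X in _ + X]big1 ?addr0 => [|k ne]; last first.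
  by apply: big1 => beta _; rewrite eq_sym (negPf ne) mul0r.
rewrite (bigD1 alpha) //= !eqxx mul1r big1 ?addr0 // => beta ne.
by rewrite (inj_eq val_inj) eq_sym (negPf ne) mul0r.
Qed.

Lemma card_off_diagonal_solutions :
  (off_diagonal_solutions R nu N #=
   bethe_sets bethe_q (fun k => N (val k)) bethe_C bethe_rhs)%card.
Proof.
pose B := bethe_sets bethe_q (fun k => N (val k)) bethe_C bethe_rhs.
(* A family of sets is ordered by the enumeration of each [W k]. The default 0 of [nth] is never
   reached for [W] in [B], since then [W k] has [N (val k)] elements. *)
pose U (W : J N -> {fset circle R}) : unknowns R N := fun k beta => nth 0 (W k) beta.
have UE W k : B W -> codom (U W k) =i W k.
  move=> WB y; have [szW _] := WB k; apply/codomP/idP => [[beta ->]|yW].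
    by rewrite mem_nth ?szW.
  have ltW : (index y (W k) < N (val k))%N by rewrite -szW index_mem.
  by exists (Ordinal ltW); rewrite /U /= nth_index.
have Uoff W : B W -> off_diagonal R N (U W).
  move=> WB k b b' /eqP; have [szW _] := WB k.
  by rewrite /U nth_uniq ?szW ?fset_uniq // => /eqP; apply: val_inj.
have fsetU W k : B W -> [fset y in codom (U W k)]%fset = W k.
  by move=> WB; apply/fsetP => y; rewrite inE UE.
apply: card_esym; apply: (@card_eq_bij _ _ _ _ (fun W => perm_class (U W))).
- move=> W WB; exists (U W) => //; split; last exact: Uoff.
  move=> m alpha; rewrite SCE_lhs; have [_ /(_ (U W m alpha))] := WB m.
  under eq_bigr => k do rewrite -(fsetU W k WB) (sum_fset_codom (Uoff W WB k)).
  by apply; rewrite -UE // codom_f.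
- move=> W W' WB W'B e; apply/funext => k; apply/fsetP => y.
  rewrite -(UE W) // -(UE W') //; apply: perm_class_codom.
  by rewrite e; apply: perm_class_refl.
- move=> _ [u [uS uoff] <-].
  pose W k := [fset y in codom (u k)]%fset.
  have WB : B W.
    move=> k; split.
      rewrite (perm_size (perm_fset_seq _)) ?size_codom ?card_ord //.
      by rewrite map_inj_uniq ?enum_uniq //; apply: uoff.
    move=> y; rewrite inE => /codomP[beta ->].
    under eq_bigr => l do rewrite (sum_fset_codom (uoff l)).
    by rewrite -SCE_lhs; apply: uS.
  exists W => //; apply: perm_class_eq; apply: codom_perm_class => // k y.
  by rewrite UE // inE.
Qed.

(** On the diagonal the summand [N] of [bethe_q] cancels against the [-1] of [bethe_C] times [N],
    which leaves the entries of [F]. *)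
Lemma bethe_intE (k l : J N) :
  bethe_mx bethe_q (fun k => N (val k)) bethe_C k l =
  (k == l)%:Z * P nu N (val k) + 2 * (minn (val k) (val l))%:Z * (N (val l))%:Z.
Proof.
rewrite /bethe_mx /bethe_C bethe_qE mulrBl; have [->|_] := eqVneq k l.
  by rewrite !mul1r addrACA subrr addr0.
by rewrite !mul0r subr0.
Qed.

(** Extracting [N] from each column leaves the min matrix with diagonal additions [P / N >= 0]; this
    division is why the matrix is mapped to [R]. *)
Lemma bethe_det_gt0 :
  0 < \det (\matrix_(i < #|{: J N}|, j < #|{: J N}|)
     bethe_mx bethe_q (fun k => N (val k)) bethe_C (enum_val i) (enum_val j)).
Proof.
rewrite -(ltr0z R) -(det_map_mx intr).
pose ev (i : 'I_#|{: J N}|) : J N := enum_val i.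
have N_gt0 i : (0 < N (val (ev i)))%N by have := valP (ev i); rewrite in_J => /andP[].
pose d i : R := (P nu N (val (ev i)))%:~R / (N (val (ev i)))%:R.
have -> : map_mx intr (\matrix_(i < #|{: J N}|, j < #|{: J N}|)
     bethe_mx bethe_q (fun k => N (val k)) bethe_C (enum_val i) (enum_val j))
   = (\matrix_(i, j) ((i == j)%:R * d i + 2 * (minn (val (ev i)) (val (ev j)))%:R))
     *m diag_mx (\row_j (N (val (ev j)))%:R) :> 'M[R]_#|{: J N}|.
  apply/matrixP => i j; rewrite mul_mx_diag !mxE bethe_intE -/(ev i) -/(ev j).
  rewrite (inj_eq enum_val_inj) intrD !intrM [RHS]mulrDl; congr (_ + _).
  have [->|_] := eqVneq i j; last by rewrite !mul0r.
  by rewrite !mul1r divfK // pnatr_eq0 -lt0n.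
rewrite det_mulmx det_diag mulr_gt0 //; last first.
  by apply: prodr_gt0 => i _; rewrite mxE ltr0n.
apply: det_diag_minn_gt0 => [i j /val_inj/enum_val_inj //|i|i].
  by have := valP (ev i); rewrite in_J => /andP[].
by rewrite divr_ge0 // ler0z; apply/P_ge0/valP.
Qed.

End Classes.

(** * Binomial identities and the final count *)

Lemma gbinom_nat (q n : nat) : gbinom q%:R n = 'C(q, n)%:R.
Proof.
have ffactE : \prod_(i < n) (q%:R - i%:R) = (q ^_ n)%:R :> rat.
  elim: n => [|n IHn]; first by rewrite big_ord0 ffactn0.
  rewrite big_ord_recr /= IHn ffactnSr natrM.
  (* For [q < n] the new factor is negative, but the falling factorial has already vanished. *)
  have [le_nq|lt_qn] := leqP n q; first by rewrite natrB.
  by rewrite ffact_small // !mul0r.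
rewrite /gbinom ffactE -bin_ffact natrM mulfK //.
by rewrite pnatr_eq0 -lt0n fact_gt0.
Qed.

(** This is the absorption identity [n * 'C(q, n) = q * 'C(q - 1, n - 1)]. *)
Lemma mul_gbinom (q n : nat) : (0 < n)%N -> (0 < q)%N ->
  n%:R^-1 * gbinom (q%:R - 1) n.-1 = 'C(q, n)%:R / q%:R.
Proof.
case: n q => // n [//|q] _ _; rewrite -[in X in gbinom X](natr1 q) addrK gbinom_nat.
apply: (canRL (mulfK _)); rewrite ?pnatr_eq0 // -mulrA.
apply: (canLR (mulKf _)); rewrite ?pnatr_eq0 //.
by rewrite -!natrM mulnC mul_bin_diag.
Qed.

Theorem theorem3p5 (R : realType) (nu N : natseq)
    (hP : forall m : nat, m \in J N -> 0 <= P nu N m) :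
  exists n : nat,
    (off_diagonal_solutions R nu N #= `I_n)%card /\ n%:R = R_number nu N.
Proof.
pose q := @bethe_q nu N; pose n (k : J N) := N (val k).
have n_gt0 k : (0 < n k)%N by have := valP k; rewrite in_J => /andP[].
have q_gt0 k : (0 < q k)%N.
  by rewrite -ltz_nat bethe_qE // ltr_wpDl ?ltz_nat ?n_gt0 //; apply/hP/valP.
have q_le k : (q k <= \max_l q l)%N by apply: leq_bigmax.
have D_gt0 := bethe_det_gt0 R hP.
have [m [mP mE]] := card_bethe_sets (n := n) (@bethe_rhs R nu N) q_gt0 q_le (lt0r_neq0 D_gt0).
exists m; split; first exact: card_eq_trans (card_off_diagonal_solutions R hP) mP.
have prod_neq0 : \prod_k (q k)%:R != 0 :> rat.
  by apply/prodf_neq0 => k _; rewrite pnatr_eq0 -lt0n.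
(* Multiplying by the product of the [q k] brings in the double count [mE]; positivity of the
   determinant then removes its absolute value. *)
apply: (mulIf prod_neq0); rewrite -natr_prod -natrM mE mulnC natrM.
rewrite /R_number -mulrA !natr_prod -big_split /=; congr (_ * _) => /=.
  rewrite natr_absz gtr0_norm // -(det_map_mx intr); congr (\det _).
  by apply/matrixP => i j; rewrite !mxE bethe_intE.
apply: eq_bigr => k _.
have -> : (P nu N (val k))%:~R + (N (val k))%:R = (q k)%:R :> rat.
  by rewrite [(q k)%:R]pmulrn bethe_qE // [RHS]intrD -pmulrn.
by rewrite mul_gbinom ?(n_gt0 k) // divfK // pnatr_eq0 -lt0n.
Qed.
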